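(* There exist a constant $\alpha>1.587$ and a function $\varepsilon(n)\to 0$ as $n\to\infty$ such that for every positive integer $n$, \[Q(n)\le \left((1+\varepsilon(n))\frac{n}{e^{\alpha}}\right)^{n}.\]
   Context: $Q(n)$ denotes the number of ways to place $n$ queens on the (ordinary, non-toroidal) $n\times n$ chessboard with squares $(i,j)$, $1\le i,j\le n$, so that no two queens share a row, a column, or a diagonal (a set of squares with $i-j$ constant or with $i+j$ constant). *)

(* Defs.v *)
From mathcomp Require Import all_boot all_order all_algebra.
From mathcomp Require Import reals topology normedtype sequences exp.
Set Implicit Arguments.
Unset Strict Implicit.
Unset Printing Implicit Defensive.
Import Order.TTheory GRing.Theory Num.Theory.
Import numFieldNormedType.Exports.

(* Squares are 0-indexed: 'I_n * 'I_n stands for {1, ..., n}^2. Rows, columns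
   and (non-toroidal) diagonals are not affected by the shift; the differences
   below are taken in int, since subtraction on nat is truncated. *)
Definition share_line (n : nat) (s t : 'I_n * 'I_n) : bool :=
  [|| s.1 == t.1,
      s.2 == t.2,
      (s.1%:Z - s.2%:Z == t.1%:Z - t.2%:Z)%R
    | (s.1 + s.2 == t.1 + t.2)%N].

Definition queens_configuration (n : nat) (S : {set 'I_n * 'I_n}) : bool :=
  (#|S| == n) &&
  [forall s in S, forall t in S, (s != t) ==> ~~ share_line s t].

Definition Q (n : nat) : nat :=
  #|[set S : {set 'I_n * 'I_n} | queens_configuration S]|.

(* Main.v *)
(* Colour the rows at random with K colours, and fill them in order of colour,
   choosing in each row uniformly among the squares not yet attacked. A given
   configuration X arises with probability at least the product of the 1 / N_i(X),
   where N_i(X) counts the squares of row i not attacked by queens of X in rows of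
   smaller colour. These probabilities sum to at most 1, so by Jensen's inequality
   ln Q(n) is at most the maximum over X of the expectation, over the colouring, of
   the sum of the ln N_i(X).

   If b queens of X attack a square of row i from other rows, the square survives
   with probability s^b given that a proportion s of the colours is not smaller than
   that of i. For the squares not in X, b is 1, 2 or 3, and since a queen near the
   border attacks fewer squares but each row and each column holds only one queen,
   the average of b is at least 9/4 - O(1/n). Convexity of b |-> s^b bounds the mean
   of N_i by n s (3 + 5 s^2) / 8 + 1. Averaging the logarithm over s yields
   alpha = - int_0^1 ln (s (3 + 5 s^2) / 8) ds = 1.5875..., and a large constant K
   approximates this integral well enough. *)
Require Import Defs.
From mathcomp Require Import all_boot all_order all_algebra.
From mathcomp Require Import reals topology normedtype sequences exp.
From mathcomp Require Import derive realfun.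
From mathcomp Require Import zify ring lra.
Set Implicit Arguments.
Unset Strict Implicit.
Unset Printing Implicit Defensive.
Import Order.TTheory GRing.Theory Num.Theory.
Import numFieldNormedType.Exports.

(** * Queen configurations as functions from rows to columns *)

Definition nonattacking (n : nat) (X : {ffun 'I_n -> 'I_n}) : bool :=
  [forall i, forall j, (i != j) ==> ~~ share_line (i, X i) (j, X j)].

Lemma nonattackingP (n : nat) (X : {ffun 'I_n -> 'I_n}) :
  reflect (forall i j, share_line (i, X i) (j, X j) -> i = j) (nonattacking X).
Proof.
apply: (iffP forallP) => [nX i j|nX i].
  by move/forallP: (nX i) => /(_ j); case: eqP => //= _ /negbTE ->.
by apply/forallP => j; apply/implyP; apply: contraNN => /nX ->.
Qed.

(** Having [n] queens in distinct rows fills every row, so each configuration is the graph of a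
    nonattacking function. *)
Lemma Q_le_nonattacking (n : nat) :
  Q n <= #|[set X : {ffun 'I_n -> 'I_n} | nonattacking X]|.
Proof.
pose graph (X : {ffun 'I_n -> 'I_n}) := [set (i, X i) | i : 'I_n].
apply: (@leq_trans #|graph @: [set X | nonattacking X]|); last exact: leq_imset_card.
apply/subset_leq_card/subsetP => S; rewrite inE => /andP[/eqP cardS /forallP nS].
have shareS s t : s \in S -> t \in S -> share_line s t -> s = t.
  move=> sS tS; move: (nS s); rewrite sS /= => /forallP /(_ t); rewrite tS /=.
  by case: eqP => //= _ /negbTE ->.
have rows : fst @: S = setT.
  apply/eqP; rewrite eqEcard subsetT cardsT card_ord card_in_imset ?cardS ?leqnn //.
  by move=> s t sS tS st; apply: shareS => //; rewrite /share_line st eqxx.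
have ex i : exists j, (i, j) \in S.
  have /imsetP[[i' j] sS /= ->] : i \in fst @: S by rewrite rows.
  by exists j.
pose X := [ffun i => xchoose (ex i)].
have XS i : (i, X i) \in S by rewrite ffunE; exact: xchooseP (ex i).
apply/imsetP; exists X.
  rewrite inE; apply/nonattackingP => i j /(shareS _ _ (XS i) (XS j)).
  by case.
apply/setP => -[i j]; apply/idP/imsetP => [ijS|[i' _ [-> ->]]]; last exact: XS.
exists i => //; apply: shareS => //; by rewrite /share_line /= eqxx.
Qed.

(** * Counting the attackers of all squares *)

Definition attackers (n : nat) (X : {ffun 'I_n -> 'I_n}) (i j : 'I_n) : {set 'I_n} :=
  [set k | (k != i) && share_line (k, X k) (i, j)].

Lemma share_lineE (n : nat) (k x i j : 'I_n) : share_line (k, x) (i, j) =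
  [|| k == i, x == j, k + j == i + x | i + j == k + x].
Proof.
rewrite /share_line /=; congr [|| _, _, _ | _]; last by rewrite eq_sym.
by lia.
Qed.

Lemma attackers_self (n : nat) (X : {ffun 'I_n -> 'I_n}) (i : 'I_n) :
  nonattacking X -> attackers X i (X i) = set0.
Proof.
move=> /nonattackingP nX; apply/setP => k; rewrite !inE.
by apply/negP => /andP[ki /nX kE]; rewrite kE eqxx in ki.
Qed.

Lemma nonattacking_inj (n : nat) (X : {ffun 'I_n -> 'I_n}) :
  nonattacking X -> injective X.
Proof.
move=> /nonattackingP nX i j Xij; apply: nX.
by rewrite share_lineE Xij eqxx orbT.
Qed.

(** [X] is a permutation, so column [j] holds a queen; it lies outside row [i] when [j != X i]. *)
Lemma attackers_gt0 (n : nat) (X : {ffun 'I_n -> 'I_n}) (i j : 'I_n) :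
  nonattacking X -> j != X i -> 0 < #|attackers X i j|.
Proof.
move=> nX jXi.
have [f _ fK] := injF_bij (nonattacking_inj nX).
apply/card_gt0P; exists (f j); rewrite inE share_lineE fK eqxx orbT andbT.
by apply: contraNneq jXi => <-; rewrite fK.
Qed.

(** The column and the two diagonals through the square hold at most one queen each. *)
Lemma attackers_le3 (n : nat) (X : {ffun 'I_n -> 'I_n}) (i j : 'I_n) :
  nonattacking X -> #|attackers X i j| <= 3.
Proof.
move=> /nonattackingP nX.
pose C := [set k | X k == j].
pose D := [set k : 'I_n | k + j == i + X k].
pose A := [set k : 'I_n | i + j == k + X k].
have [C1 D1 A1] : [/\ #|C| <= 1, #|D| <= 1 & #|A| <= 1].
  by split; apply/card_le1_eqP => k l; rewrite !inE => /eqP kE /eqP lE;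
    apply: nX; rewrite share_lineE ?kE ?lE ?eqxx ?orbT //; lia.
apply: (@leq_trans #|C :|: D :|: A|); last first.
  by have := (leq_card_setU (C :|: D) A).1; have := (leq_card_setU C D).1; lia.
apply/subset_leq_card/subsetP => k; rewrite !inE share_lineE.
by case: eqP => //= _; rewrite orbA.
Qed.

Lemma sum_nat_interval (n a b : nat) : b <= n -> \sum_(i < n) (a <= i < b) = b - a.
Proof.
move=> bn; rewrite -(big_mkord xpredT (fun i => (a <= i < b : nat))).
rewrite (@big_cat_nat _ _ _ b) //= [X in _ + X]big1_seq ?addn0; last first.
  by move=> i; rewrite mem_index_iota; lia.
elim: b {bn} => [|b IH]; first by rewrite big_nil sub0n.
rewrite big_nat_recr //= (_ : \sum_(0 <= i < b) _ = b - a); first by lia.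
by rewrite -IH; apply: eq_big_nat => i; lia.
Qed.

Lemma sum_eq_shift (n u v : nat) :
  \sum_(j < n) (u + j == v) = (u <= v < u + n).
Proof.
have -> : \sum_(j < n) (u + j == v) = \sum_(j < n) ((v - u <= j < (v - u).+1) && (u <= v)).
  by apply: eq_bigr => j _; lia.
case: (leqP u v) => uv /=; last first.
  by rewrite big1 // => j _; rewrite andbF.
under eq_bigr do rewrite andbT.
case: (ltnP v (u + n)) => vn; first by rewrite sum_nat_interval; lia.
by rewrite big1 // => j _; have := ltn_ord j; lia.
Qed.

(** The two truncated differences add up to the absolute value of [k - x]. *)
Lemma diagonal_length (n : nat) (k x : 'I_n) :
  \sum_(i < n) \sum_(j < n) (k + j == i + x) = n - ((k - x) + (x - k)).
Proof.
under eq_bigr do rewrite sum_eq_shift.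
have -> : \sum_(i < n) (k <= i + x < k + n)
    = \sum_(i < n) (k - x <= i < minn n (n + k - x)).
  by apply: eq_bigr => i _; have := ltn_ord i; have := ltn_ord x; lia.
by rewrite sum_nat_interval ?geq_minl //; lia.
Qed.

Lemma antidiagonal_length (n : nat) (k x : 'I_n) :
  \sum_(i < n) \sum_(j < n) (i + j == k + x)
    = n - ((k + x).+1 - n + (n - (k + x).+1)).
Proof.
under eq_bigr do rewrite sum_eq_shift.
have -> : \sum_(i < n) (i <= k + x < i + n)
    = \sum_(i < n) ((k + x).+1 - n <= i < minn n (k + x).+1).
  by apply: eq_bigr => i _; have := ltn_ord i; have := ltn_ord x; lia.
by rewrite sum_nat_interval ?geq_minl //; have := ltn_ord x; lia.
Qed.

(* Twice the excess over n/2 of |2i + 1 - n|, the (doubled) distance of row i to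
   the middle of the board. *)
Definition excess (n i : nat) : nat := (4 * i + 2 - 3 * n) + (n - (4 * i + 2)).

Lemma sum_excess (n : nat) : 4 * \sum_(i < n) excess n i <= n ^ 2.
Proof.
(* For [c <= 4 * m] the increment of [(4 * m - c) ^ 2] is exactly [8 * (4 * m + 2 - c)]. *)
have half c m : 8 * \sum_(0 <= i < m) (4 * i + 2 - c) <= (4 * m - c) ^ 2.
  elim: m => [|m IH]; first by rewrite big_nil.
  rewrite big_nat_recr //= mulnDr; case: (leqP c (4 * m)) => cm.
    have [d E] : exists d, 4 * m = c + d by exists (4 * m - c); lia.
    by move: IH; rewrite mulnS E; nia.
  move: IH; rewrite (_ : 4 * m - c = 0); last by lia.
  have : 4 * m.+1 - c <= 3 by lia.
  rewrite (_ : 4 * m + 2 - c = 4 * m.+1 - c - 2); last by lia.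
  by case: (4 * m.+1 - c) => [|[|[|[|]]]] //; lia.
(* The reflection [i -> n - 1 - i] swaps the two parts of [excess]. *)
have fold : \sum_(i < n) excess n i = 2 * \sum_(0 <= i < n) (4 * i + 2 - 3 * n).
  rewrite big_split /= mul2n -addnn big_mkord; congr (_ + _).
  rewrite (reindex_inj rev_ord_inj) /=; apply: eq_bigr => i _.
  by have := ltn_ord i; lia.
have := half (3 * n) n; rewrite fold (_ : 4 * n - 3 * n = n); lia.
Qed.

(** With [u = 2k + 1 - n] and [v = 2x + 1 - n] the lengths add up to [2n - max(|u|, |v|)]; the
    excess compensates a maximum above [n/2]. *)
Lemma diagonals_length_ge (n : nat) (k x : 'I_n) :
  6 * n <= 4 * (\sum_(i < n) \sum_(j < n) (k + j == i + x)
             + \sum_(i < n) \sum_(j < n) (i + j == k + x))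
           + 2 * excess n k + 2 * excess n x.
Proof.
rewrite diagonal_length antidiagonal_length /excess.
by have := ltn_ord k; have := ltn_ord x; lia.
Qed.

(** Double counting over the queens: columns give [4 n^2], diagonals [6 n^2] up to excess terms,
    which cost at most [n^2] since [X] permutes the columns. *)
Lemma sum_attackers_ge (n : nat) (X : {ffun 'I_n -> 'I_n}) : nonattacking X ->
  9 * n ^ 2 <= 4 * \sum_i \sum_j #|attackers X i j| + 12 * n.
Proof.
move=> nX.
pose d (k : 'I_n) := \sum_(i < n) \sum_(j < n) (k + j == i + X k).
pose a (k : 'I_n) := \sum_(i < n) \sum_(j < n) (i + j == k + X k).
(* For [k != i] the three lines through queen [k] meet row [i] in distinct squares, if at all; for
   [k = i] each is counted once and cancelled by the 3. *)
have row (k i : 'I_n) : \sum_(j < n) (k \in attackers X i j) + 3 * (k == i) =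
    1 + \sum_(j < n) (k + j == i + X k) + \sum_(j < n) (i + j == k + X k).
  have <- : \sum_(j < n) (X k == j) = 1.
    by rewrite (bigD1 (X k)) //= eqxx big1 ?addn0 // => j; rewrite eq_sym => /negbTE ->.
  have [->|ki] := eqVneq k i.
    rewrite big1 ?add0n => [|j _]; last by rewrite inE eqxx.
    have -> : \sum_(j < n) (i + j == i + X i) = 1.
      by rewrite sum_eq_shift; have := ltn_ord (X i); lia.
    rewrite (_ : \sum_(j < n) (X i == j) = 1) //.
    by rewrite (bigD1 (X i)) //= eqxx big1 ?addn0 // => j; rewrite eq_sym => /negbTE ->.
  rewrite muln0 addn0 -!big_split /=; apply: eq_bigr => j _.
  by rewrite inE share_lineE; move: ki; rewrite -!val_eqE /=; lia.
have count : \sum_i \sum_j #|attackers X i j| + 3 * n = \sum_(k < n) (n + (d k + a k)).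
  have -> : \sum_i \sum_j #|attackers X i j|
      = \sum_(k < n) \sum_(i < n) \sum_(j < n) (k \in attackers X i j).
    rewrite [RHS]exchange_big; apply: eq_bigr => i _ /=.
    rewrite [RHS]exchange_big; apply: eq_bigr => j _ /=.
    by rewrite -sum1_card big_mkcond /=; apply: eq_bigr => k _; case: ifP.
  have -> : 3 * n = \sum_(k < n) \sum_(i < n) 3 * (k == i).
    have one (k : 'I_n) : \sum_(i < n) 3 * (k == i) = 3.
      by rewrite (bigD1 k) //= eqxx big1 // => i; rewrite eq_sym => /negbTE ->.
    under eq_bigr do rewrite one.
    by rewrite sum_nat_const card_ord mulnC.
  rewrite -big_split /=; apply: eq_bigr => k _.
  rewrite -big_split /=; under eq_bigr do rewrite row.
  by rewrite !big_split /= sum1_card card_ord addnA.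
have : \sum_(k < n) 6 * n <=
    \sum_(k < n) (4 * (d k + a k) + 2 * excess n k + 2 * excess n (X k)).
  by apply: leq_sum => k _; exact: diagonals_length_ge.
rewrite sum_nat_const card_ord.
have -> : \sum_(k < n) (4 * (d k + a k) + 2 * excess n k + 2 * excess n (X k))
    = 4 * (\sum_k d k + \sum_k a k) + 2 * \sum_(k < n) excess n k
      + 2 * \sum_(k < n) excess n (X k).
  by rewrite -(big_split _ _ _ d) /= !big_distrr /= -!big_split.
have -> : \sum_(k < n) excess n (X k) = \sum_(k < n) excess n k.
  by rewrite [RHS](reindex_inj (nonattacking_inj nX)).
move: count (sum_excess n); rewrite !big_split /= sum_nat_const card_ord.
set s := \sum_i \sum_j _; set t := \sum_(i < n) excess n i.
by set u := \sum_i d i; set v := \sum_i a i; nia.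
Qed.

(** * Filling the rows in a given order *)

Local Open Scope classical_set_scope.
Local Open Scope ring_scope.

(* The product of the [(w i X)^-1] is at most the probability that [X] is produced
   by filling the entries in the order [r], each uniformly among the values that
   can still be completed inside [S]. *)
Lemma kraft (R : realFieldType) (I T : finType) (S : {set {ffun I -> T}})
    (r : seq I) (w : I -> {ffun I -> T} -> nat) :
  {in S &, forall X Y : {ffun I -> T}, forall i, i \notin r -> X i = Y i} ->
  (forall X r1 i r2, X \in S -> r = r1 ++ i :: r2 ->
    (#|[set (Y : {ffun I -> T}) i | Y in [set Y in S | all (fun k => Y k == X k) r1]]|
      <= w i X)%N) ->
  \sum_(X in S) \prod_(i <- r) (w i X)%:R^-1 <= 1 :> R.
Proof.
elim: r S => [|i r IH] S agree wP.
  under eq_bigr do rewrite big_nil.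
  rewrite sumr_const lern1; apply/card_le1_eqP => X Y XS YS.
  by apply/ffunP => i; exact: agree.
(* Condition on the first entry filled: by induction, each of its [#|V|] possible values contributes
   at most [1 / #|V|]. *)
pose V := [set (Y : {ffun I -> T}) i | Y in S].
pose S' v := [set Y : {ffun I -> T} in S | Y i == v].
rewrite (partition_big (fun X : {ffun I -> T} => X i) (mem V)) /=; last first.
  by move=> X XS; exact: imset_f.
have block v : v \in V ->
    \sum_(X in S | X i == v) \prod_(k <- i :: r) (w k X)%:R^-1 <= #|V|%:R^-1 :> R.
  move=> vV; have V0 : (0 < #|V|)%N by apply/card_gt0P; exists v.
  apply: (@le_trans _ _ (#|V|%:R^-1 * \sum_(X in S' v) \prod_(k <- r) (w k X)%:R^-1)).
    rewrite mulr_sumr (eq_bigl (mem (S' v))); last by move=> X; rewrite !inE.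
    apply: ler_sum => X; rewrite !inE => /andP[XS _]; rewrite big_cons.
    have Vw : (#|V| <= w i X)%N.
      apply: leq_trans (wP X [::] i r XS erefl); apply/subset_leq_card/imsetS.
      by apply/subsetP => Y YS; rewrite inE YS.
    rewrite ler_wpM2r ?prodr_ge0 // ?lef_pV2 ?posrE ?ltr0n ?ler_nat //.
      by move=> k _; rewrite invr_ge0.
    exact: leq_trans V0 Vw.
  rewrite ler_piMr ?invr_ge0 //; apply: IH.
    move=> X Y; rewrite !inE => /andP[XS /eqP Xi] /andP[YS /eqP Yi] k kr.
    have [->|ki] := eqVneq k i; first by rewrite Xi Yi.
    by apply: agree => //; rewrite inE negb_or ki.
  move=> X r1 k r2; rewrite !inE => /andP[XS /eqP Xi] rE.
  apply: leq_trans (wP X (i :: r1) k r2 XS _); last by rewrite rE.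
  apply/subset_leq_card/imsetS/subsetP => Y; rewrite !inE /= Xi.
  by case/andP => /andP[-> ->] ->.
apply: le_trans (ler_sum _ block) _.
rewrite -[leLHS]/(\sum_(v in V) #|V|%:R^-1) sumr_const -[leLHS]mulr_natl.
have [->|V0] := eqVneq #|V| 0%N; first by rewrite mul0r.
by rewrite divff // pnatr_eq0.
Qed.

(* Only the queens in rows of strictly smaller colour are taken into account. *)
Definition available (n K : nat) (X : {ffun 'I_n -> 'I_n}) (c : {ffun 'I_n -> 'I_K})
    (i : 'I_n) : {set 'I_n} :=
  [set j | [forall k in attackers X i j, (c i <= c k)%N]].

Lemma available_gt0 (n K : nat) (X : {ffun 'I_n -> 'I_n})
    (c : {ffun 'I_n -> 'I_K}) (i : 'I_n) :
  nonattacking X -> (0 < #|available X c i|)%N.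
Proof.
move=> nX; apply/card_gt0P; exists (X i); rewrite inE attackers_self //.
by apply/forall_inP => k; rewrite inE.
Qed.

(** Sort the rows by colour: whatever the order among ties, rows of strictly smaller colour come
    before [i], so a completion can only use available squares in row [i]. *)
Lemma kraft_available (R : realFieldType) (n K : nat) (c : {ffun 'I_n -> 'I_K}) :
  \sum_(X : {ffun 'I_n -> 'I_n} | nonattacking X)
    \prod_i (#|available X c i|)%:R^-1 <= 1 :> R.
Proof.
pose e (k l : 'I_n) := (c k <= c l)%N.
pose r := sort e (enum 'I_n).
have memr i : i \in r by rewrite mem_sort mem_enum.
rewrite (eq_bigl (mem [set X : {ffun 'I_n -> 'I_n} | nonattacking X])); last first.
  by move=> X; rewrite !inE.
rewrite (eq_bigr (fun X => \prod_(i <- r) (#|available X c i|)%:R^-1)); last first.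
  move=> X _; rewrite -big_enum; apply: perm_big.
  by rewrite perm_sym perm_sort.
apply: kraft => [X Y _ _ i|X r1 i r2 _ rE]; first by rewrite memr.
apply/subset_leq_card/subsetP => j /imsetP[Y]; rewrite !inE => /andP[nY /allP XY] ->.
apply/forall_inP => k; rewrite inE => /andP[ki].
rewrite leqNgt; apply: contraTN => cki.
have kr1 : k \in r1.
  have e_tr : transitive e by move=> a b d; exact: leq_trans.
  have : sorted e r by apply: sort_sorted => a b; exact: leq_total.
  rewrite (sorted_pairwise e_tr) rE pairwise_cat pairwise_cons.
  move=> /and3P[_ _ /andP[/allP ir2 _]].
  have := memr k; rewrite rE mem_cat inE (negbTE ki) /=.
  by case/orP => [//|/ir2]; rewrite /e leqNgt cki.
rewrite -(eqP (XY k kr1)).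
by apply: contra ki => /(elimT (nonattackingP Y) nY) ->.
Qed.

(** * Jensen's inequality for exp and ln *)

Lemma sum_expR_ge (R : realType) (T : finType) (A : {pred T}) (y : T -> R) :
  (0 < #|A|)%N ->
  #|A|%:R * expR ((\sum_(a in A) y a) / #|A|%:R) <= \sum_(a in A) expR (y a).
Proof.
move=> A0; set m := _ / _.
(* Compare exp with its tangent line at the mean [m]. *)
apply: (@le_trans _ _ (\sum_(a in A) expR m * (1 + (y a - m)))); last first.
  apply: ler_sum => a _.
  have -> : expR (y a) = expR m * expR (y a - m) by rewrite -expRD addrC subrK.
  by rewrite ler_pM2l ?expR_gt0 // expR_ge1Dx.
have Em : \sum_(a in A) y a = m *+ #|A|.
  by rewrite -mulr_natr divfK // pnatr_eq0 -lt0n.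
rewrite -mulr_sumr big_split /= sumrB !sumr_const Em subrr addr0.
by rewrite mulrC.
Qed.

Lemma sum_ln_le (R : realType) (T : finType) (A : {pred T}) (x : T -> R) :
  (forall a, a \in A -> 0 < x a) -> (0 < #|A|)%N ->
  \sum_(a in A) ln (x a) <= #|A|%:R * ln ((\sum_(a in A) x a) / #|A|%:R).
Proof.
move=> x0 A0; have A0' : 0 < #|A|%:R :> R by rewrite ltr0n.
have le : expR ((\sum_(a in A) ln (x a)) / #|A|%:R) <= (\sum_(a in A) x a) / #|A|%:R.
  rewrite ler_pdivlMr // mulrC.
  apply: le_trans (sum_expR_ge (fun a => ln (x a)) A0) _.
  by apply: ler_sum => a aA; rewrite lnK // posrE x0.
rewrite -ler_pdivrMl // mulrC -ler_expR lnK // posrE.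
exact: lt_le_trans (expR_gt0 _) le.
Qed.

(** * Independent uniform colours *)

Lemma card_ord_ge (K : nat) (k : 'I_K) : #|[pred m : 'I_K | k <= m]%N| = (K - k)%N.
Proof.
rewrite -(@sum_nat_interval K k K) // -sum1_card big_mkcond /=.
by apply: eq_bigr => m _; rewrite inE ltn_ord andbT; case: leq.
Qed.

(** The conditions bear on each row separately, so the count is a product: one colour for [i],
    [K - k] for each row in [A], [K] for the others. *)
Lemma card_colorings (R : realFieldType) (n K : nat) (i : 'I_n) (k : 'I_K)
    (A : {set 'I_n}) : i \notin A ->
  #|[pred c : {ffun 'I_n -> 'I_K} | (c i == k) && [forall l in A, k <= c l]%N]|%:R
    = K%:R ^+ n / K%:R * ((K - k)%:R / K%:R) ^+ #|A| :> R.
Proof.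
move=> iA; have K0 : K%:R != 0 :> R by rewrite pnatr_eq0 -lt0n (leq_ltn_trans _ (ltn_ord k)).
pose F (l : 'I_n) : {pred 'I_K} := [pred m : 'I_K |
  if l == i then m == k else (l \in A) ==> (k <= m)%N].
rewrite (eq_card (B := family F)); last first.
  move=> c; rewrite !inE; apply/andP/familyP => [[/eqP cik /forall_inP cA] l|cF].
    rewrite inE; have [->|li] := eqVneq l i; first by rewrite cik.
    by apply/implyP => /cA.
  split; first by have := cF i; rewrite inE eqxx.
  apply/forall_inP => l lA; have := cF l; rewrite inE lA.
  by case: eqVneq => [li|//]; rewrite -li lA in iA.
rewrite card_family foldrE big_map big_enum /= natr_prod.
pose q : R := (K - k)%:R / K%:R.
rewrite (eq_bigr (fun l => K%:R * (if l == i then K%:R^-1 else 1)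
                           * (if l \in A then q else 1))) => [|l _]; last first.
  rewrite /F; have [->|li] := eqVneq l i.
    by rewrite (negbTE iA) mulr1 divff // card1.
  rewrite mulr1; case: ifP => lA /=; last by rewrite mulr1 card_ord.
  by rewrite card_ord_ge /q mulrCA divff ?mulr1.
rewrite !big_split /= prodr_const card_ord -!big_mkcond /= big_pred1_eq.
by rewrite prodr_const.
Qed.

(** * Numerical bound on the integral of [ln (surv s)] *)

(* Asymptotic density of squares not attacked from the rows filled so far, in the
   worst case, when a proportion [s] of the rows is still to be filled. *)
Definition surv (R : fieldType) (s : R) : R := s * ((3 + 5 * s ^+ 2) / 8).

Lemma surv_gt0 (R : realFieldType) (s : R) : 0 < s -> 0 < surv s.
Proof. by move=> s0; rewrite /surv mulr_gt0 // divr_gt0 //; nra. Qed.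

Lemma ler_surv (R : realFieldType) (s t : R) : 0 <= s -> s <= t -> surv s <= surv t.
Proof.
move=> s0 st; have sst : s ^+ 2 <= t ^+ 2 by rewrite lerXn2r // nnegrE (le_trans s0).
rewrite /surv ler_pM //; first by rewrite divr_ge0 //; nra.
by lra.
Qed.

(* With x = s^2, 10 s^2 / (3 + 5 s^2) = 2x / (x + 3/5). Replacing 1 / (x + 3/5) by
   the Newton step U (2 - (x + 3/5) U) with U = (15 - 14 x + 5 x^2) / 10 gives a
   polynomial lower bound, here called [minorant]; [minorant_prim] is its primitive. *)
Definition minorant_prim (R : fieldType) (s : R) : R :=
  11 / 10 * s ^+ 3 - 253 / 250 * s ^+ 5 + 781 / 875 * s ^+ 7
  - 131 / 225 * s ^+ 9 + 5 / 22 * s ^+ 11 - 1 / 26 * s ^+ 13.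

Definition minorant (R : fieldType) (s : R) : R :=
  33 / 10 * s ^+ 2 - 253 / 50 * s ^+ 4 + 781 / 125 * s ^+ 6
  - 131 / 25 * s ^+ 8 + 5 / 2 * s ^+ 10 - 1 / 2 * s ^+ 12.

(** A Newton step for a reciprocal errs by a multiple of the squared residual [S]. *)
Lemma minorant_le (R : realFieldType) (s : R) :
  minorant s <= 10 * s ^+ 2 / (3 + 5 * s ^+ 2).
Proof.
have d0 : 0 < 3 + 5 * s ^+ 2 by nra.
rewrite ler_pdivlMr // -subr_ge0.
set S := 1 - (s ^+ 2 + 3 / 5) * ((15 - 14 * s ^+ 2 + 5 * s ^+ 4) / 10).
have -> : 10 * s ^+ 2 - minorant s * (3 + 5 * s ^+ 2) = 10 * (s * S) ^+ 2.
  by rewrite /minorant /S; field.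
by rewrite mulr_ge0 // sqr_ge0.
Qed.

(** Integration by parts of [ln (surv s)] leaves the integral of [10 * s ^+ 2 / (3 + 5 * s ^+ 2)],
    replaced here by [minorant_prim]; increments thus overestimate the true integral. *)
Definition log_surv_prim (R : realType) (s : R) : R :=
  s * (ln s + ln ((3 + 5 * s ^+ 2) / 8)) - s - minorant_prim s.

Lemma is_derive_log_surv_prim (R : realType) (s : R) : 0 < s ->
  is_derive s 1 (@log_surv_prim R)
    (ln (surv s) + (10 * s ^+ 2 / (3 + 5 * s ^+ 2) - minorant s)).
Proof.
move=> s0; have d0 : 0 < (3 + 5 * s ^+ 2) / 8 by nra.
have dP : is_derive s 1 (@minorant_prim R) (minorant s).
  rewrite /minorant_prim; apply: is_derive_eq.
  by rewrite /minorant /GRing.scale /=; field.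
have dq : is_derive s 1 (fun s : R => (3 + 5 * s ^+ 2) / 8) (10 * s / 8).
  by apply: is_derive_eq; rewrite /GRing.scale /=; field.
have dls := is_derive1_ln s0.
have dlq : is_derive s 1 (fun s : R => ln ((3 + 5 * s ^+ 2) / 8)) _ :=
  @is_derive1_comp R (@ln R) (fun s => (3 + 5 * s ^+ 2) / 8) s _ _
    (is_derive1_ln d0) dq.
rewrite /log_surv_prim.
apply: is_derive_eq; rewrite /surv (lnM s0 d0) /GRing.scale /=.
by field; rewrite !gt_eqF //; nra.
Qed.

(** By the mean value theorem, since the derivative at [x] is at least [ln (surv x)] and [surv]
    increases. *)
Lemma ln_surv_le_increment (R : realType) (a b : R) : 0 < a -> a < b ->
  (b - a) * ln (surv a) <= log_surv_prim b - log_surv_prim a.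
Proof.
move=> a0 ab.
have dF x (ax : a <= x) := is_derive_log_surv_prim (lt_le_trans a0 ax).
have dFab x : x \in `]a, b[ -> is_derive x 1 (@log_surv_prim R)
    (ln (surv x) + (10 * x ^+ 2 / (3 + 5 * x ^+ 2) - minorant x)).
  by rewrite in_itv /= => /andP[/ltW ax _]; exact: dF.
have [|x xab ->] := MVT ab dFab.
  apply: derivable_within_continuous => x; rewrite in_itv /= => /andP[ax _].
  by have [] := dF x ax.
rewrite mulrC ler_wpM2r ?subr_ge0 ?(ltW ab) //.
have ax : a <= x by move: xab; rewrite in_itv /= => /andP[/ltW].
apply: (@le_trans _ _ (ln (surv x))).
  by rewrite ler_ln ?posrE ?surv_gt0 ?ler_surv ?(ltW a0) ?(lt_le_trans a0).
by rewrite lerDl subr_ge0 minorant_le.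
Qed.

(** A left Riemann sum on [[1/K, 1]]; the term [k = K] vanishes because [surv 1 = 1]. *)
Lemma sum_ln_surv_le (R : realType) (K : nat) : (0 < K)%N ->
  \sum_(1 <= k < K.+1) ln (surv (k%:R / K%:R))
    <= K%:R * (log_surv_prim 1 - log_surv_prim K%:R^-1 :> R).
Proof.
move=> K0; have K0' : 0 < K%:R :> R by rewrite ltr0n.
have lnsurv1 : ln (surv 1) = 0 :> R.
  by rewrite /surv (_ : _ * _ = 1) ?ln1 //; field.
rewrite big_nat_recr //= divff ?gt_eqF // lnsurv1 addr0.
have -> : log_surv_prim 1 - log_surv_prim K%:R^-1 =
    \sum_(1 <= k < K) (log_surv_prim (k.+1%:R / K%:R)
                       - log_surv_prim (k%:R / K%:R)) :> R.
  by rewrite (telescope_sumr (fun k => log_surv_prim (k%:R / K%:R))) // divff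
       ?gt_eqF // mul1r.
rewrite mulr_sumr.
apply: ler_sum_nat => k /andP[k0 _]; rewrite -[leLHS](mulVKf (lt0r_neq0 K0')).
rewrite ler_pM2l //.
have := @ln_surv_le_increment R (k%:R / K%:R) (k.+1%:R / K%:R).
rewrite -mulrBl -natrB // subSnn mul1r; apply.
  by rewrite divr_gt0 ?ltr0n.
by rewrite ltr_pM2r ?invr_gt0 // ltr_nat.
Qed.

Lemma log_surv_prim_gap (R : realType) :
  log_surv_prim 1 - log_surv_prim (4 ^- 10) < - (1587 / 1000) :> R.
Proof.
(* As [log_surv_prim 1 = -1.58716...] and the other endpoint contributes less than [10^-4], this
   crude bound suffices. *)
have ln4 : ln 4 < 4 :> R by apply: ln_sublinear.
have l1 : ln (4 ^- 10) = - (10 * ln 4) :> R.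
  by rewrite lnV ?posrE ?exprn_gt0 // lnXn // mulr_natl.
have l2 : - ln 4 <= ln ((3 + 5 * (4 ^- 10) ^+ 2) / 8) :> R.
  by rewrite -lnV ?posrE // ler_ln ?posrE //; nra.
have e1 : (3 + 5 * 1 ^+ 2) / 8 = 1 :> R by field.
rewrite /log_surv_prim e1 ln1 l1 addr0 mulr0 /minorant_prim.
move: l2; set l := ln (_ / _) => l2.
lra.
Qed.

Lemma survival_constant (R : realType) : exists2 K, (0 < K)%N &
  \sum_(1 <= k < K.+1) ln (surv (k%:R / K%:R)) < - (1587 / 1000) * K%:R :> R.
Proof.
exists (4 ^ 10)%N; first by rewrite expn_gt0.
apply: (le_lt_trans (sum_ln_surv_le _ _)); first by rewrite expn_gt0.
rewrite natrX mulrC ltr_pM2r ?exprn_gt0 //.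
exact: log_surv_prim_gap.
Qed.

(** * Expected number of available squares *)

(* For [b] in {1, 2, 3} the bound is the chord of the convex map [b |-> s ^+ b]
   through [1] and [3]; the last term corrects it at [b = 0]. *)
Lemma expr_attackers_le (R : realFieldType) (n : nat) (X : {ffun 'I_n -> 'I_n})
    (i j : 'I_n) (s : R) : nonattacking X -> 0 <= s <= 1 ->
  s ^+ #|attackers X i j| <= s * (3 - s ^+ 2) / 2
    - #|attackers X i j|%:R * (s * (1 - s ^+ 2) / 2)
    + (j == X i)%:R * (1 - s * (3 - s ^+ 2) / 2).
Proof.
move=> nX /andP[s0 s1]; have [->|jX] := eqVneq j (X i).
  by rewrite attackers_self // cards0 expr0 mul0r subr0 mul1r addrC subrK.
rewrite mul0r addr0.
have := attackers_gt0 nX jX; have := attackers_le3 i j nX.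
case: #|_| => [|[|[|[|]]]] //= _ _; rewrite ?expr1.
- by rewrite le_eqVlt; apply/orP; left; apply/eqP; field.
- have : 0 <= s * (s - 1) ^+ 2 by rewrite mulr_ge0 ?sqr_ge0.
  by nra.
- by rewrite le_eqVlt; apply/orP; left; apply/eqP; field.
Qed.

(** The chord decreases in the number of attackers, so the average [9/4] may be inserted, where the
    chord takes the value [surv s]. *)
Lemma sum_expr_attackers_le (R : realFieldType) (n : nat)
    (X : {ffun 'I_n -> 'I_n}) (s : R) : nonattacking X -> 0 <= s <= 1 ->
  \sum_i \sum_j s ^+ #|attackers X i j| <= n%:R ^+ 2 * surv s + n%:R.
Proof.
move=> nX s01; have /andP[s0 s1] := s01.
apply: (le_trans (ler_sum _ (fun i _ => ler_sum _ (fun j _ =>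
  expr_attackers_le i j nX s01)))).
set u := s * (3 - s ^+ 2) / 2; set v := s * (1 - s ^+ 2) / 2.
have -> : \sum_i \sum_j (u - #|attackers X i j|%:R * v + (j == X i)%:R * (1 - u))
    = n%:R ^+ 2 * u - (\sum_i \sum_j #|attackers X i j|)%:R * v + n%:R * (1 - u).
  have row i : \sum_j (u - #|attackers X i j|%:R * v + (j == X i)%:R * (1 - u))
      = n%:R * u - (\sum_j #|attackers X i j|)%:R * v + (1 - u).
    rewrite big_split sumrB /= sumr_const card_ord mulr_natl natr_sum mulr_suml.
    congr (_ + _); rewrite (bigD1 (X i)) //= eqxx mul1r big1 ?addr0 // => j.
    by move=> /negbTE ->; rewrite mul0r.
  rewrite (eq_bigr _ (fun i _ => row i)).
  rewrite big_split sumrB /= !sumr_const card_ord natr_sum mulr_suml.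
  by rewrite -[(n%:R * u) *+ n]mulr_natl -[(1 - u) *+ n]mulr_natl expr2 mulrA.
have v0 : 0 <= v.
  by rewrite /v divr_ge0 // mulr_ge0 // subr_ge0 -(expr1n R 2) lerXn2r ?nnegrE.
have surv_uv : surv s = u - 9 / 4 * v by rewrite /surv /u /v; field.
(* The boundary loss [3 * n * v] and the correction [n * (1 - u)] add up to [n * (1 - s ^+ 3)],
   hence the error term [n]. *)
have uv3 : 3 * v = u - s ^+ 3 by rewrite /u /v; field.
have s3 : 0 <= n%:R * s ^+ 3 by rewrite mulr_ge0 ?exprn_ge0.
have total : 9 * n%:R ^+ 2 <= 4 * (\sum_i \sum_j #|attackers X i j|)%:R + 12 * n%:R :> R.
  by rewrite -natrX -!natrM -natrD ler_nat sum_attackers_ge.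
have := ler_wpM2r v0 total; have := congr1 ( *%R n%:R) uv3.
rewrite surv_uv; move: s3; set N := n%:R; set B := (\sum_i _)%:R.
by clearbody u v N B; lra.
Qed.

Lemma sum_available (R : realFieldType) (n K : nat) (X : {ffun 'I_n -> 'I_n})
    (i : 'I_n) (k : 'I_K) :
  \sum_(c : {ffun 'I_n -> 'I_K} | c i == k) #|available X c i|%:R
  = K%:R ^+ n / K%:R * \sum_j ((K - k)%:R / K%:R) ^+ #|attackers X i j| :> R.
Proof.
rewrite mulr_sumr.
under eq_bigr do rewrite -sum1_card big_mkcond /= natr_sum.
rewrite exchange_big /=; apply: eq_bigr => j _.
rewrite -(@card_colorings _ _ _ i); last by rewrite inE eqxx.
rewrite -sum1_card natr_sum big_mkcond [RHS]big_mkcond /=.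
apply: eq_bigr => c _; rewrite !inE; case: eqP => //= ->.
by case: ifP.
Qed.

(** * Expected logarithms and the resulting bound *)

Lemma sum_ln_available_le (R : realType) (n K : nat) (X : {ffun 'I_n -> 'I_n}) :
  (0 < n)%N -> (0 < K)%N -> nonattacking X ->
  \sum_(c : {ffun 'I_n -> 'I_K}) \sum_i ln #|available X c i|%:R
  <= K%:R ^+ n * (n%:R / K%:R *
       \sum_(k < K) ln (n%:R * surv ((K - k)%:R / K%:R) + 1)) :> R.
Proof.
move=> n0 K0 nX.
have n0' : 0 < n%:R :> R by rewrite ltr0n.
have K0' : 0 < K%:R :> R by rewrite ltr0n.
have M0 : 0 < K%:R ^+ n / K%:R :> R by rewrite divr_gt0 ?exprn_gt0.
pose s (k : 'I_K) : R := (K - k)%:R / K%:R.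
have s0 k : 0 < s k by rewrite divr_gt0 // ltr0n subn_gt0.
have s1 k : s k <= 1 by rewrite ler_pdivrMr // mul1r ler_nat leq_subr.
pose T k i := \sum_j s k ^+ #|attackers X i j|.
have T0 k i : 0 < T k i.
  rewrite /T (bigD1 i) //= ltr_wpDr ?exprn_gt0 ?sumr_ge0 // => j _.
  by rewrite exprn_ge0 ?ltW.
have cardc (i : 'I_n) (k : 'I_K) :
    #|[pred c : {ffun 'I_n -> 'I_K} | c i == k]|%:R = K%:R ^+ n / K%:R :> R.
  have := @card_colorings R n K i k set0; rewrite inE cards0 expr0 mulr1 => <- //.
  congr _%:R; apply: eq_card => c; rewrite !inE andbC.
  by case: forall_inP => // -[] l; rewrite inE.
(* Jensen over the colourings with [c i = k]. *)
have inner (i : 'I_n) (k : 'I_K) :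
    \sum_(c : {ffun 'I_n -> 'I_K} | c i == k) ln #|available X c i|%:R
    <= K%:R ^+ n / K%:R * ln (T k i).
  have := @sum_ln_le R _ [pred c : {ffun 'I_n -> 'I_K} | c i == k]
    (fun c => #|available X c i|%:R).
  rewrite /= sum_available cardc [X in ln X]mulrAC divff ?mul1r ?gt_eqF //; apply.
    by move=> c _; rewrite ltr0n available_gt0.
  by rewrite -(ltr0n R) cardc.
(* Jensen over the rows, because attackers are bounded below only on average over the board. *)
have outer k : \sum_i ln (T k i) <= n%:R * ln (n%:R * surv (s k) + 1).
  have := @sum_ln_le R _ 'I_n (T k); rewrite card_ord.
  move=> /(_ (fun i _ => T0 k i) n0) /le_trans; apply.
  have sum0 : 0 < \sum_i T k i.
    apply: lt_le_trans (T0 k (Ordinal n0)) _.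
    by rewrite (bigD1 (Ordinal n0)) //= lerDl sumr_ge0 // => i _; exact: ltW.
  have bound0 : 0 < n%:R * surv (s k) + 1.
    by rewrite addr_gt0 // mulr_gt0 // surv_gt0.
  rewrite ler_pM2l // ler_ln ?posrE // ?divr_gt0 // ler_pdivrMr //.
  apply: le_trans (sum_expr_attackers_le nX _) _; first by rewrite ltW // s1.
  by rewrite mulrDl mul1r expr2 mulrAC.
rewrite exchange_big /=.
apply: (@le_trans _ _ (\sum_(i < n) \sum_(k < K) K%:R ^+ n / K%:R * ln (T k i))).
  apply: ler_sum => i _; rewrite (partition_big (fun c : {ffun 'I_n -> 'I_K} => c i) xpredT) //=.
  by apply: ler_sum => k _; exact: inner.
rewrite exchange_big /=.
under eq_bigr do rewrite -mulr_sumr.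
rewrite -mulr_sumr (_ : _ * (_ / _ * _) = K%:R ^+ n / K%:R *
  (n%:R * \sum_(k < K) ln (n%:R * surv (s k) + 1))); last by rewrite /s; ring.
rewrite ler_pM2l // mulr_sumr; apply: ler_sum => k _; exact: outer.
Qed.

(** Summed over all colourings, the Kraft weights total at most [K ^ n], while Jensen for exp gives
    each [X] at least [K ^ n * expR (- b)]. *)
Lemma nonattacking_le (R : realType) (n K : nat) : (0 < n)%N -> (0 < K)%N ->
  #|[set X : {ffun 'I_n -> 'I_n} | nonattacking X]|%:R
  <= expR (n%:R / K%:R * \sum_(k < K) ln (n%:R * surv ((K - k)%:R / K%:R) + 1)) :> R.
Proof.
move=> n0 K0; set b := _ * _.
have K0' : 0 < K%:R :> R by rewrite ltr0n.
have M0 : (0 < #|{ffun 'I_n -> 'I_K}|)%N by rewrite card_ffun !card_ord expn_gt0 K0.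
have ME : #|{ffun 'I_n -> 'I_K}|%:R = K%:R ^+ n :> R.
  by rewrite card_ffun !card_ord natrX.
have each (X : {ffun 'I_n -> 'I_n}) : nonattacking X -> K%:R ^+ n * expR (- b) <=
    \sum_(c : {ffun 'I_n -> 'I_K}) \prod_i (#|available X c i|%:R^-1 : R).
  move=> nX.
  rewrite (eq_bigr (fun c => expR (- \sum_i ln #|available X c i|%:R))); last first.
    move=> c _; rewrite -sumrN expR_sum; apply: eq_bigr => i _.
    by rewrite -lnV ?posrE ?ltr0n ?available_gt0 // lnK // posrE invr_gt0 ltr0n available_gt0.
  apply: le_trans (sum_expR_ge _ M0); rewrite ME ler_pM2l ?exprn_gt0 // ler_expR.
  rewrite sumrN mulNr lerN2 ler_pdivrMr ?exprn_gt0 // mulrC.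
  exact: sum_ln_available_le.
have : \sum_(X : {ffun 'I_n -> 'I_n} | nonattacking X) (K%:R ^+ n * expR (- b)) <= K%:R ^+ n.
  apply: le_trans (ler_sum _ each) _; rewrite exchange_big /= -ME -sumr_const.
  by apply: ler_sum => c _; exact: kraft_available.
rewrite sumr_const -[leLHS]mulr_natl mulrCA ger_pMr ?exprn_gt0 //.
rewrite expRN ler_pdivrMr ?expR_gt0 // mul1r cardsE.
exact.
Qed.

Theorem theorem3 (R : realType) :
  exists (alpha : R) (eps : nat -> R),
    [/\ 1587 / 1000 < alpha,
        eps n @[n --> \oo] --> (0 : R)
      & forall n : nat, (0 < n)%N ->
          (Q n)%:R <= ((1 + eps n) * (n%:R / expR alpha)) ^+ n].
Proof.
have [K K0 sumK] := survival_constant R.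
have K0' : 0 < K%:R :> R by rewrite ltr0n.
set S := \sum_(_ <= _ < _) _ in sumK.
(* The factor [1 + 3K/n] absorbs the [+ 1] inside the logarithm: [s >= 1/K] and [surv s >= 3s/8]
   give [3 * K * surv s >= 9/8]. *)
exists (- (S / K%:R)), (fun n => 3 * K%:R * n%:R^-1); split.
- by rewrite ltrNr ltr_pdivrMr.
- rewrite -cvg_shiftS /=.
  have : (3 * K%:R * harmonic n) @[n --> \oo] --> 3 * K%:R * (0 : R).
    by apply: cvgMl_tmp; exact: cvg_harmonic.
  by rewrite mulr0.
move=> n n0; have n0' : 0 < n%:R :> R by rewrite ltr0n.
apply: (@le_trans _ _ #|[set X : {ffun 'I_n -> 'I_n} | nonattacking X]|%:R).
  by rewrite ler_nat Q_le_nonattacking.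
apply: le_trans (nonattacking_le R n0 K0) _.
have SE : S = \sum_(k < K) ln (surv ((K - k)%:R / K%:R)).
  rewrite /S big_add1 /= big_mkord (reindex_inj rev_ord_inj) /=.
  by apply: eq_bigr => k _; rewrite subnSK.
have e0 : 0 <= 3 * K%:R / n%:R :> R by rewrite divr_ge0 // mulr_ge0.
have e1 : 0 < 1 + 3 * K%:R / n%:R :> R by rewrite ltr_wpDr.
rewrite expRN invrK.
rewrite -[(1 + _) * _]lnK ?posrE ?mulr_gt0 ?expR_gt0 // -expRM_natl ler_expR.
rewrite -mulrA ler_pM2l // !lnM ?posrE ?mulr_gt0 ?expR_gt0 // expRK.
rewrite ler_pdivrMl //.
have -> : K%:R * (ln (1 + 3 * K%:R / n%:R) + (ln n%:R + S / K%:R)) =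
   \sum_(k < K) (ln (1 + 3 * K%:R / n%:R) + ln n%:R + ln (surv ((K - k)%:R / K%:R))).
  rewrite big_split /= -SE sumr_const card_ord -[_ *+ _]mulr_natl.
  by field; rewrite gt_eqF.
apply: ler_sum => k _; set s := _ / K%:R.
have s0 : 0 < s by rewrite divr_gt0 // ltr0n subn_gt0.
have sK : 1 <= s * K%:R by rewrite divfK ?gt_eqF // ler1n subn_gt0.
have ss0 := surv_gt0 s0.
have en0 : 0 < (1 + 3 * K%:R / n%:R) * n%:R :> R by exact: mulr_gt0.
have l0 : 0 < n%:R * surv s + 1 by exact: addr_gt0 (mulr_gt0 n0' ss0) ltr01.
have r0 : 0 < (1 + 3 * K%:R / n%:R) * n%:R * surv s by exact: mulr_gt0.
rewrite -lnM // -lnM // ler_ln //.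
have -> : (1 + 3 * K%:R / n%:R) * n%:R * surv s = n%:R * surv s + 3 * K%:R * surv s.
  by field; rewrite gt_eqF.
rewrite lerD2l /surv.
have : 0 <= s * K%:R * s ^+ 2 by rewrite mulr_ge0 ?sqr_ge0 ?(le_trans _ sK).
by lra.
Qed.
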